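(* Let $A$ be a semiprime associative algebra. Then for every idempotent $e \in Q_s(A)$ such that $eA + Ae \subseteq A$ we have $Q_s(eAe) \cong eQ_s(A)e$.
   Context: All algebras are algebras over a fixed associative and commutative ring $\Phi$; associative algebras are not assumed to be unital. For a semiprime associative algebra $A$, $Q^l_{max}(A)$ denotes the maximal left quotient algebra of $A$, and $Q_s(A)$ denotes the Martindale symmetric algebra of quotients of $A$, i.e. the set of all $q \in Q^l_{max}(A)$ for which there is an essential (two-sided) ideal $I$ of $A$ with $Iq + qI \subseteq A$. An ideal is essential if its intersection with every nonzero ideal is nonzero. *)

(* Defs.v *)
From HB Require Import structures.
From mathcomp Require Import all_boot all_algebra.
From mathcomp Require Import boolp classical_sets.

Set Implicit Arguments.
Unset Strict Implicit.
Unset Printing Implicit Defensive.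

Import GRing.Theory.
Local Open Scope quotient_scope.
Local Open Scope ring_scope.
Local Open Scope classical_set_scope.

(* MathComp rings are unital; nuAlgType Phi is the structure of associative,
   not necessarily unital (nor commutative), algebras over Phi. *)

Reserved Notation "x ** y" (at level 40, left associativity).

HB.mixin Record Lmodule_isNuAlg (Phi : comPzRingType) A of GRing.Lmodule Phi A := {
  numul : A -> A -> A;
  numulA : associative numul;
  numulDl : left_distributive numul +%R;
  numulDr : right_distributive numul +%R;
  numulZl : forall (c : Phi) (x y : A), numul (c *: x) y = c *: numul x y;
  numulZr : forall (c : Phi) (x y : A), numul x (c *: y) = c *: numul x y
}.

#[short(type="nuAlgType")]
HB.structure Definition NuAlg (Phi : comPzRingType) :=
  {A of GRing.Lmodule Phi A & Lmodule_isNuAlg Phi A}.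

Notation "x ** y" := (numul x y) : ring_scope.

Section NuAlgTheory.
Variables (Phi : comPzRingType) (A : nuAlgType Phi).
Implicit Types x y : A.

Lemma numul0r x : 0 ** x = 0.
Proof. by rewrite -{1}(scale0r (0 : A)) numulZl scale0r. Qed.

Lemma numulr0 x : x ** 0 = 0.
Proof. by rewrite -{1}(scale0r (0 : A)) numulZr scale0r. Qed.

Lemma numulBr x y z : x ** (y - z) = x ** y - x ** z.
Proof. by rewrite numulDr -(scaleN1r z) numulZr scaleN1r. Qed.

Lemma numulBl x y z : (y - z) ** x = y ** x - z ** x.
Proof. by rewrite numulDl -(scaleN1r z) numulZl scaleN1r. Qed.

End NuAlgTheory.

Definition nualg_morphism (Phi : comPzRingType) (A B : nuAlgType Phi)
    (f : A -> B) : Prop :=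
  (forall (c : Phi) x y, f (c *: x + y) = c *: f x + f y) /\
  (forall x y, f (x ** y) = f x ** f y).

Definition nualg_isomorphic (Phi : comPzRingType) (A B : nuAlgType Phi) : Prop :=
  exists2 f : A -> B, nualg_morphism f & bijective f.

Section Morphisms.
Variables (Phi : comPzRingType) (A B : nuAlgType Phi) (f : A -> B).
Hypothesis fM : nualg_morphism f.

Lemma nualg_morphismD x y : f (x + y) = f x + f y.
Proof. by have := fM.1 1 x y; rewrite !scale1r. Qed.

Lemma nualg_morphism0 : f 0 = 0.
Proof. by apply: (addrI (f 0)); rewrite -nualg_morphismD !addr0. Qed.

Lemma nualg_morphismZ c x : f (c *: x) = c *: f x.
Proof. by have := fM.1 c x 0; rewrite nualg_morphism0 !addr0. Qed.

Lemma nualg_morphismB x y : f (x - y) = f x - f y.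
Proof. by rewrite -(scaleN1r y) nualg_morphismD nualg_morphismZ scaleN1r. Qed.

End Morphisms.

Section Ideals.
Variables (Phi : comPzRingType) (A : nuAlgType Phi).
Implicit Types (I J : set A) (x y z : A).

Definition submodule_set I : Prop :=
  I 0 /\ forall (c : Phi) x y, I x -> I y -> I (c *: x + y).

Definition left_ideal I : Prop :=
  submodule_set I /\ forall a x, I x -> I (a ** x).

Definition ideal I : Prop :=
  left_ideal I /\ forall a x, I x -> I (x ** a).

Definition nonzero_ideal I : Prop := ideal I /\ exists2 x, I x & x != 0.

Definition essential_ideal I : Prop :=
  ideal I /\
  forall J, nonzero_ideal J -> exists2 x, (I `&` J) x & x != 0.

Definition dense_left_ideal I : Prop :=
  left_ideal I /\
  forall p q, p != 0 -> exists a, a ** p != 0 /\ I (a ** q).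

(* I^2 = 0 iff all products of two elements of I vanish. *)
Definition semiprime : Prop :=
  forall I, nonzero_ideal I -> exists x y, [/\ I x, I y & x ** y != 0].

Lemma idealI I J : ideal I -> ideal J -> ideal (I `&` J).
Proof.
move=> [[[I0 ID] Il] Ir] [[[J0 JD] Jl] Jr]; split; first split; first split=> //.
- by move=> c x y [? ?] [? ?]; split; [apply: ID | apply: JD].
- by move=> a x [? ?]; split; [apply: Il | apply: Jl].
by move=> a x [? ?]; split; [apply: Ir | apply: Jr].
Qed.

Lemma dense_left_idealI I J :
  dense_left_ideal I -> dense_left_ideal J -> dense_left_ideal (I `&` J).
Proof.
move=> [[[I0 ID] Il] Id] [[[J0 JD] Jl] Jd]; split; first split; first split=> //.
- by move=> c x y [? ?] [? ?]; split; [apply: ID | apply: JD].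
- by move=> a x [? ?]; split; [apply: Il | apply: Jl].
move=> p q /(Id p q)[a [ap aq]]; have [b [bap baq]] := Jd _ (a ** q) ap.
by exists (b ** a); rewrite -!numulA; do 2!split=> //; apply: Il.
Qed.

Lemma ideal_setT : ideal [set: A]. Proof. by []. Qed.

Lemma essential_idealI I J :
  essential_ideal I -> essential_ideal J -> essential_ideal (I `&` J).
Proof.
move=> [iI eI] [iJ eJ]; split; first exact: idealI.
move=> K [iK nK]; have [x [Jx Kx] nx] := eJ K (conj iK nK).
have [|y [Iy [Jy Ky]] ny] := eI (J `&` K); last by exists y.
by split; [apply: idealI | exists x].
Qed.

Hypothesis sA : semiprime.

Lemma semiprime_sqr0 I :
  ideal I -> (forall x y, I x -> I y -> x ** y = 0) -> forall x, I x -> x = 0.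
Proof.
move=> iI I2 x Ix; apply: contrapT => /eqP nx.
have [|y [z [Iy Iz /eqP[]]]] := sA (I := I); first by split=> //; exists x.
exact: I2.
Qed.

Lemma semiprime_faithful x : (forall a, a ** x = 0) -> x = 0.
Proof.
move=> h; apply: (semiprime_sqr0 (I := [set y : A | forall a, a ** y = 0])) => //.
  split; first split; first split.
  - by move=> a; rewrite numulr0.
  - by move=> c y z /= hy hz a; rewrite numulDr numulZr hy hz scaler0 addr0.
  - by move=> a y /= hy b; rewrite numulA hy.
  by move=> a y /= hy b; rewrite numulA hy numul0r.
Qed.

Lemma dense_setT : dense_left_ideal [set: A].
Proof.
split=> // p q np; apply: contrapT => h; move/eqP: np; apply.
apply: semiprime_faithful => a; apply: contrapT => /eqP nap.
by apply: h; exists a.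
Qed.

Lemma semiprime_elt x : (forall a, x ** a ** x = 0) -> x = 0.
Proof.
move=> hx.
pose P := [set y : A | forall a, x ** a ** y = 0].
pose R := [set z : A | forall a y, P y -> z ** a ** y = 0].
have iP : ideal P.
  split; first split; first split.
  - by move=> a; rewrite numulr0.
  - by move=> c y z /= hy hz a; rewrite numulDr numulZr hy hz scaler0 addr0.
  - by move=> a y /= hy b; rewrite numulA -(numulA x) hy.
  by move=> a y /= hy b; rewrite numulA hy numul0r.
have iR : ideal R.
  split; first split; first split.
  - by move=> a y _; rewrite !numul0r.
  - move=> c y z /= hy hz a w Pw.
    by rewrite !numulDl !numulZl hy // hz // scaler0 addr0.
  - by move=> a z /= hz b y Py; rewrite -!numulA (numulA z) hz // numulr0.
  by move=> a z /= hz b y Py; rewrite -(numulA z) hz.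
have iT := idealI iR iP; set T := R `&` P in iT.
have T0 u v w : T u -> T w -> u ** v ** w = 0 by move=> [Ru _] [_ Pw]; apply: Ru.
have Tx : T x by split=> //= a y; apply.
pose N := [set z : A | T z /\ forall t, T t -> z ** t = 0].
have iN : ideal N.
  case: iT => -[[T00 TD] Tl] Tr; split; first split; first split.
  - by split=> // t _; rewrite numul0r.
  - move=> c y z [Ty hy] [Tz hz]; split; first exact: TD.
    by move=> t Tt; rewrite numulDl numulZl hy // hz // scaler0 addr0.
  - move=> a z [Tz hz]; split; first exact: Tl.
    by move=> t Tt; rewrite -numulA hz // numulr0.
  move=> a z [Tz hz]; split; first exact: Tr.
  by move=> t Tt; rewrite -numulA hz //; apply: Tl.
have N0 z : N z -> z = 0.
  by apply: (semiprime_sqr0 iN) => a b [_ ha] [Tb _]; apply: ha.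
apply: (semiprime_sqr0 iT) Tx => u v Tu Tv; apply: N0; split.
  by apply: iT.1.2.
by move=> t Tt; apply: T0.
Qed.

End Ideals.

Arguments semiprime {Phi} A.

(* The maximal left quotient algebra of a semiprime algebra A, as the direct limit of Hom_A(I, A) over
   the dense left ideals I. Homomorphisms of left modules act on the right of
   their argument, so f g stands for "f first, then g"; the values of fn
   outside dom are irrelevant. Qmax_left_quotient and Qmax_maximal below show
   that the result is the largest left quotient algebra of A. *)

Section PartialHom.
Variables (Phi : comPzRingType) (A : nuAlgType Phi).

Record phom := PHom {
  dom : set A;
  fn : A -> A;
  dom_dense : dense_left_ideal dom;
  fn_linear : forall (c : Phi) x y,
    dom x -> dom y -> fn (c *: x + y) = c *: fn x + fn y;
  fn_left_linear : forall a x, dom x -> fn (a ** x) = a ** fn x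
}.

HB.instance Definition _ := gen_eqMixin phom.
HB.instance Definition _ := gen_choiceMixin phom.

Implicit Types f g h : phom.

Definition phom_eqv f g : bool :=
  `[< exists K : set A,
        [/\ dense_left_ideal K, K `<=` dom f `&` dom g &
            forall x, K x -> fn f x = fn g x] >].

Lemma phom_eqvI f g :
  (forall x, dom f x -> dom g x -> fn f x = fn g x) -> phom_eqv f g.
Proof.
move=> h; apply/asboolP; exists (dom f `&` dom g); split=> //.
  by apply: dense_left_idealI; apply: dom_dense.
by move=> x [? ?]; apply: h.
Qed.

Lemma phom_eqvE f g :
  phom_eqv f g -> forall x, dom f x -> dom g x -> fn f x = fn g x.
Proof.
move=> /asboolP[K [[_ Kd] KS Kfg]] x fx gx; apply: contrapT => /eqP.
rewrite -subr_eq0 => nz; have [a [na /Kfg]] := Kd _ x nz.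
rewrite !fn_left_linear // => e.
by rewrite numulBr e subrr eqxx in na.
Qed.

Lemma phom_eqv_refl : reflexive phom_eqv.
Proof. by move=> f; apply: phom_eqvI. Qed.

Lemma phom_eqv_sym : symmetric phom_eqv.
Proof.
by move=> f g; apply/idP/idP => h; apply: phom_eqvI => x ? ?;
   rewrite (phom_eqvE h).
Qed.

Lemma phom_eqv_trans : transitive phom_eqv.
Proof.
move=> g f h /asboolP[K [Kd KS Kfg]] /asboolP[L [Ld LS Lgh]].
apply/asboolP; exists (K `&` L); split; first exact: dense_left_idealI.
  by move=> x [/KS[? _] /LS[_ ?]].
by move=> x [Kx Lx]; rewrite Kfg // Lgh.
Qed.

Canonical phom_equiv :=
  EquivRel phom_eqv phom_eqv_refl phom_eqv_sym phom_eqv_trans.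

Lemma dom0 f : dom f 0. Proof. by case: (dom_dense f) => -[[]]. Qed.

Lemma domD f c x y : dom f x -> dom f y -> dom f (c *: x + y).
Proof. by case: (dom_dense f) => -[[_ h] _] _; apply: h. Qed.

Lemma domM f a x : dom f x -> dom f (a ** x).
Proof. by case: (dom_dense f) => -[_ h] _; apply: h. Qed.

Lemma fn0 f : fn f 0 = 0.
Proof. by rewrite -{1}(numul0r 0) fn_left_linear ?numul0r //; apply: dom0. Qed.

Lemma fnD f x y : dom f x -> dom f y -> fn f (x + y) = fn f x + fn f y.
Proof. by move=> ? ?; rewrite -{1}(scale1r x) fn_linear // scale1r. Qed.

Local Obligation Tactic := idtac.

Program Definition phom_add f g : phom :=
  @PHom (dom f `&` dom g) (fun x => fn f x + fn g x) _ _ _.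
Next Obligation. by move=> f g; apply: dense_left_idealI; apply: dom_dense. Qed.
Next Obligation.
by move=> f g c x y /= [? ?] [? ?]; rewrite !fn_linear // scalerDr addrACA.
Qed.
Next Obligation.
by move=> f g a x /= [? ?]; rewrite !fn_left_linear // numulDr.
Qed.

Program Definition phom_scale (d : Phi) f : phom :=
  @PHom (dom f) (fun x => d *: fn f x) _ _ _.
Next Obligation. by move=> d f; apply: dom_dense. Qed.
Next Obligation.
by move=> d f c x y /= ? ?; rewrite fn_linear // scalerDr !scalerA mulrC.
Qed.
Next Obligation.
by move=> d f a x /= ?; rewrite fn_left_linear // numulZr.
Qed.

Program Definition phom_mul f g : phom :=
  @PHom [set x | dom f x /\ dom g (fn f x)] (fun x => fn g (fn f x)) _ _ _.
Next Obligation.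
move=> f g; split; first split; first split.
- by split; [|rewrite fn0]; apply: dom0.
- move=> c x y [? ?] [? ?]; split; first exact: domD.
  by rewrite fn_linear //; apply: domD.
- by move=> a x [? ?]; split; [|rewrite fn_left_linear //]; apply: domM.
move=> p q np; have [a [ap fa]] := (dom_dense f).2 p q np.
have [b [bap gb]] := (dom_dense g).2 _ (fn f (a ** q)) ap.
exists (b ** a); rewrite -!numulA; split=> //; split; first exact: domM.
by rewrite fn_left_linear.
Qed.
Next Obligation. by move=> f g c x y /= [? ?] [? ?]; rewrite fn_linear // fn_linear. Qed.
Next Obligation.
by move=> f g a x /= [? ?]; rewrite fn_left_linear // fn_left_linear.
Qed.

Hypothesis sA : semiprime A.

Program Definition phom_rmul (a : A) : phom :=
  @PHom [set: A] (fun x => x ** a) _ _ _.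
Next Obligation. by move=> a; apply: dense_setT. Qed.
Next Obligation. by move=> a c x y _ _ /=; rewrite numulDl numulZl. Qed.
Next Obligation. by move=> a b x _ /=; rewrite numulA. Qed.

End PartialHom.

(* sA is what provides the zero element and the embedding of A in Qmax. *)
Definition Qmax (Phi : comPzRingType) (A : nuAlgType Phi) (sA : semiprime A) :=
  {eq_quot (@phom_eqv Phi A)}.

Section Qmax.
Variables (Phi : comPzRingType) (A : nuAlgType Phi) (sA : semiprime A).

Local Notation Q := (Qmax sA).
Local Notation eqv := (@phom_eqv Phi A).

HB.instance Definition _ : EqQuotient _ eqv Q := EqQuotient.on Q.
HB.instance Definition _ := Choice.on Q.

Definition Qmax_add := lift_op2 Q (@phom_add Phi A).
Definition Qmax_scale (c : Phi) := lift_op1 Q (phom_scale c).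
Definition Qmax_mul := lift_op2 Q (@phom_mul Phi A).
Definition Qmax_in : A -> Q := fun a => \pi_Q (phom_rmul sA a).

Lemma Qmax_eqP (f g : phom A) :
  (\pi_Q f = \pi_Q g) <->
  (forall x, dom f x -> dom g x -> fn f x = fn g x).
Proof.
split=> [/eqmodP/phom_eqvE//|h]; apply/eqmodP; exact: phom_eqvI.
Qed.

Lemma repr_pi_fn (f : phom A) x :
  dom f x -> dom (repr (\pi_Q f)) x -> fn (repr (\pi_Q f)) x = fn f x.
Proof.
by move=> fx rx; apply: (Qmax_eqP _ _).1 => //; rewrite reprK.
Qed.

Lemma Qmax_addE f g : Qmax_add (\pi_Q f) (\pi_Q g) = \pi_Q (phom_add f g).
Proof.
rewrite /Qmax_add -lock; apply/Qmax_eqP => x /= [? ?] [? ?].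
by rewrite !repr_pi_fn.
Qed.

Lemma Qmax_scaleE c f : Qmax_scale c (\pi_Q f) = \pi_Q (phom_scale c f).
Proof.
by rewrite /Qmax_scale -lock; apply/Qmax_eqP => x /= ? ?; rewrite repr_pi_fn.
Qed.

Lemma Qmax_mulE f g : Qmax_mul (\pi_Q f) (\pi_Q g) = \pi_Q (phom_mul f g).
Proof.
rewrite /Qmax_mul -lock; apply/Qmax_eqP => x /= [rx grx] [fx gfx].
by move: grx; rewrite (repr_pi_fn fx rx) => grx; rewrite repr_pi_fn.
Qed.

Local Notation QE := (Qmax_addE, Qmax_scaleE, Qmax_mulE).

Lemma Qmax_addA : associative Qmax_add.
Proof.
elim/quotW=> f; elim/quotW=> g; elim/quotW=> h; rewrite !QE.
by apply/Qmax_eqP => x /=; rewrite addrA.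
Qed.

Lemma Qmax_addC : commutative Qmax_add.
Proof.
elim/quotW=> f; elim/quotW=> g; rewrite !QE.
by apply/Qmax_eqP => x /=; rewrite addrC.
Qed.

Lemma Qmax_add0 : left_id (Qmax_in 0) Qmax_add.
Proof.
elim/quotW=> f; rewrite !QE.
by apply/Qmax_eqP => x /=; rewrite numulr0 add0r.
Qed.

Lemma Qmax_addN : left_inverse (Qmax_in 0) (Qmax_scale (-1)) Qmax_add.
Proof.
elim/quotW=> f; rewrite !QE.
by apply/Qmax_eqP => x /=; rewrite numulr0 scaleN1r addNr.
Qed.

HB.instance Definition _ :=
  GRing.isZmodule.Build Q Qmax_addA Qmax_addC Qmax_add0 Qmax_addN.

Lemma Qmax_scaleA c d (u : Q) :
  Qmax_scale c (Qmax_scale d u) = Qmax_scale (c * d) u.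
Proof.
elim/quotW: u => f; rewrite !QE.
by apply/Qmax_eqP => x /=; rewrite scalerA.
Qed.

Lemma Qmax_scale1 : left_id 1 Qmax_scale.
Proof.
elim/quotW=> f; rewrite !QE.
by apply/Qmax_eqP => x /=; rewrite scale1r.
Qed.

Lemma Qmax_scaleDr : right_distributive Qmax_scale +%R.
Proof.
move=> c; elim/quotW=> f; elim/quotW=> g.
rewrite -![_ + _]/(Qmax_add _ _) !QE.
by apply/Qmax_eqP => x /=; rewrite scalerDr.
Qed.

Lemma Qmax_scaleDl (u : Q) : {morph Qmax_scale^~ u : c d / c + d}.
Proof.
elim/quotW: u => f c d.
rewrite -[Qmax_scale c _ + _]/(Qmax_add _ _) !QE.
by apply/Qmax_eqP => x /=; rewrite scalerDl.
Qed.

HB.instance Definition _ := GRing.Zmodule_isLmodule.Build Phi Q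
  Qmax_scaleA Qmax_scale1 Qmax_scaleDr Qmax_scaleDl.

Lemma Qmax_mulA : associative Qmax_mul.
Proof.
elim/quotW=> f; elim/quotW=> g; elim/quotW=> h; rewrite !QE.
by apply/Qmax_eqP.
Qed.

Lemma Qmax_mulDl : left_distributive Qmax_mul +%R.
Proof.
elim/quotW=> f; elim/quotW=> g; elim/quotW=> h.
rewrite -![_ + _]/(Qmax_add _ _) !QE.
apply/Qmax_eqP => x /= [[? ?] ?] [[? ?] [? ?]].
by rewrite fnD.
Qed.

Lemma Qmax_mulDr : right_distributive Qmax_mul +%R.
Proof.
elim/quotW=> f; elim/quotW=> g; elim/quotW=> h.
rewrite -![_ + _]/(Qmax_add _ _) !QE.
by apply/Qmax_eqP.
Qed.

Lemma Qmax_mulZl (c : Phi) (u v : Q) :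
  Qmax_mul (c *: u) v = c *: Qmax_mul u v.
Proof.
elim/quotW: u => f; elim/quotW: v => g.
rewrite -![_ *: _]/(Qmax_scale _ _) !QE.
apply/Qmax_eqP => x /= [? _] [? ?].
by rewrite -[c *: _]addr0 fn_linear ?fn0 ?addr0 //; apply: dom0.
Qed.

Lemma Qmax_mulZr (c : Phi) (u v : Q) :
  Qmax_mul u (c *: v) = c *: Qmax_mul u v.
Proof.
elim/quotW: u => f; elim/quotW: v => g.
rewrite -![_ *: _]/(Qmax_scale _ _) !QE.
by apply/Qmax_eqP.
Qed.

HB.instance Definition _ := Lmodule_isNuAlg.Build Phi Q
  Qmax_mulA Qmax_mulDl Qmax_mulDr Qmax_mulZl Qmax_mulZr.

Lemma Qmax_in_morphism : nualg_morphism Qmax_in.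
Proof.
split=> [c a b|a b].
  rewrite -[RHS]/(Qmax_add (Qmax_scale _ _) _) !QE.
  by apply/Qmax_eqP => x /= _ _; rewrite numulDr numulZr.
rewrite -[RHS]/(Qmax_mul _ _) !QE.
by apply/Qmax_eqP => x /= _ _; rewrite numulA.
Qed.

Lemma Qmax_in_mul (f : phom A) a :
  dom f a -> Qmax_in a ** \pi_Q f = Qmax_in (fn f a).
Proof.
move=> fa; rewrite -[LHS]/(Qmax_mul _ _) !QE.
by apply/Qmax_eqP => x /= _ _; rewrite fn_left_linear.
Qed.

Lemma Qmax_in_eq0 a : Qmax_in a = 0 -> a = 0.
Proof.
move/Qmax_eqP => /= h; apply: (semiprime_faithful sA) => x.
by rewrite h // numulr0.
Qed.

Lemma Qmax_in_inj : injective Qmax_in.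
Proof.
move=> a b ab; apply/eqP; rewrite -subr_eq0; apply/eqP/Qmax_in_eq0.
by rewrite (nualg_morphismB Qmax_in_morphism) ab subrr.
Qed.

End Qmax.

(* B is a left quotient algebra of A, embedded in B by j. *)
Definition left_quotient_algebra (Phi : comPzRingType) (A B : nuAlgType Phi)
    (j : A -> B) : Prop :=
  [/\ nualg_morphism j, injective j &
      forall p q : B, p != 0 ->
        exists a, j a ** p != 0 /\ exists b, j a ** q = j b].

Section QmaxUniversal.
Variables (Phi : comPzRingType) (A : nuAlgType Phi) (sA : semiprime A).
Local Notation Q := (Qmax sA).

Lemma Qmax_left_quotient : left_quotient_algebra (@Qmax_in Phi A sA).
Proof.
split; [exact: Qmax_in_morphism | exact: Qmax_in_inj |].
elim/quotW=> f; elim/quotW=> g nf; apply: contrapT => h.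
move/eqP: nf; apply.
suff e : forall x, dom f x -> dom g x -> fn f x = 0.
  apply/eqmodP; rewrite /= ; apply/asboolP; exists (dom f `&` dom g); split.
  - by apply: dense_left_idealI; apply: dom_dense.
  - by move=> x [].
  by move=> x [? ?] /=; rewrite numulr0 e.
move=> x fx gx; apply: contrapT => /eqP nfx; apply: h; exists x.
rewrite !Qmax_in_mul //; split; last by exists (fn g x).
by apply/eqP => /Qmax_in_eq0/eqP; apply/negP.
Qed.

Lemma Qmax_maximal (B : nuAlgType Phi) (j : A -> B) :
  left_quotient_algebra j ->
  exists h : B -> Q,
    [/\ nualg_morphism h, injective h & forall a, h (j a) = Qmax_in sA a].
Proof.
move=> [jM jI jQ].
pose D b := [set a | exists c, j a ** b = j c].
have /choice[F FE] : forall ba : B * A, exists c, D ba.1 ba.2 -> j ba.2 ** ba.1 = j c.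
  move=> [b a]; case: (pselect (D b a)) => [[c ?]|nD]; first by exists c.
  by exists 0 => /nD.
pose fb b a := F (b, a).
have fbE b a : D b a -> j a ** b = j (fb b a) by apply: (FE (b, a)).
have D0 b : D b 0 by exists 0; rewrite (nualg_morphism0 jM) numul0r.
have DD b c x y : D b x -> D b y -> D b (c *: x + y).
  move=> [u hu] [v hv]; exists (c *: u + v).
  by rewrite jM.1 numulDl numulZl hu hv jM.1.
have DM b a x : D b x -> D b (a ** x).
  by move=> [u hu]; exists (a ** u); rewrite jM.2 -numulA hu jM.2.
have Dd b : dense_left_ideal (D b).
  split; first by split; [split; [exact: D0 | move=> *; exact: DD]
                         | move=> *; exact: DM].
  move=> p q np; have njp : j p != 0.
    by apply: contra_neq np => e; apply: jI; rewrite e (nualg_morphism0 jM).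
  have [a [nap [c hc]]] := jQ _ (j q ** b) njp.
  exists a; split.
    by apply: contra_neq nap; rewrite -jM.2 => ->; rewrite (nualg_morphism0 jM).
  by exists c; rewrite jM.2 -numulA.
have Dl b c x y : D b x -> D b y -> fb b (c *: x + y) = c *: fb b x + fb b y.
  move=> hx hy; apply: jI; rewrite -fbE; last exact: DD.
  by rewrite !jM.1 numulDl numulZl !fbE.
have Dm b a x : D b x -> fb b (a ** x) = a ** fb b x.
  move=> hx; apply: jI; rewrite -fbE; last exact: DM.
  by rewrite !jM.2 -numulA (fbE _ _ hx).
pose h b : Q := \pi_Q (PHom (Dd b) (@Dl b) (@Dm b)).
have hM : nualg_morphism h.
  split=> [c b b'|b b'].
    rewrite -[RHS]/(Qmax_add (Qmax_scale _ _) _) Qmax_scaleE Qmax_addE.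
    apply/Qmax_eqP => x /= hx [hxb hxb']; apply: jI.
    by rewrite -fbE // jM.1 numulDr numulZr !fbE.
  rewrite -[RHS]/(Qmax_mul _ _) Qmax_mulE.
  apply/Qmax_eqP => x /= hx [hxb hxb']; apply: jI.
  by rewrite -fbE // numulA (fbE b) // fbE.
exists h; split=> //.
  move=> b b' hbb; apply/eqP; rewrite -subr_eq0; apply/negPn/negP => nb.
  have : h (b - b') = 0 by rewrite (nualg_morphismB hM) hbb subrr.
  move/Qmax_eqP => /= h0; have [a [nab [c hc]]] := jQ _ (b - b') nb.
  have Da : D (b - b') a by exists c.
  by move/eqP: nab; apply; rewrite fbE // h0 // numulr0 (nualg_morphism0 jM).
move=> a; apply/Qmax_eqP => x /= hx _; apply: jI.
by rewrite -fbE // jM.2.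
Qed.

End QmaxUniversal.

Record subalgebra (Phi : comPzRingType) (B : nuAlgType Phi) := Subalgebra {
  sa_set : set B;
  sa_submodule : submodule_set sa_set;
  sa_mul : forall x y, sa_set x -> sa_set y -> sa_set (x ** y)
}.

Section SubalgebraType.
Variables (Phi : comPzRingType) (B : nuAlgType Phi) (S : subalgebra B).

Definition sa_pred : {pred B} := fun x => `[< sa_set S x >].

Definition sa_type : Type := {x : B | x \in sa_pred}.

Lemma sa_predP x : reflect (sa_set S x) (x \in sa_pred).
Proof. exact: asboolP. Qed.

Lemma sa_submod_closed : submod_closed sa_pred.
Proof.
case: (sa_submodule S) => S0 SD; split; first exact/sa_predP.
by move=> c x y /sa_predP ? /sa_predP ?; apply/sa_predP/SD.
Qed.

HB.instance Definition _ :=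
  GRing.isSubmodClosed.Build Phi B sa_pred sa_submod_closed.

HB.instance Definition _ := [isSub of sa_type for @sval B _].
HB.instance Definition _ := [Choice of sa_type by <:].
HB.instance Definition _ := [SubChoice_isSubLmodule of sa_type by <:].

Implicit Types x y : sa_type.

Lemma sa_typeP x : sa_set S (val x). Proof. exact/sa_predP/(valP x). Qed.

Definition sa_elt (b : B) (Sb : sa_set S b) : sa_type :=
  exist _ b (introT (sa_predP b) Sb).

Definition sa_numul x y : sa_type := sa_elt (sa_mul (sa_typeP x) (sa_typeP y)).

Lemma sa_numulA : associative sa_numul.
Proof. by move=> x y z; apply: val_inj; rewrite /= numulA. Qed.

Lemma sa_numulDl : left_distributive sa_numul +%R.
Proof. by move=> x y z; apply: val_inj; rewrite /= numulDl. Qed.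

Lemma sa_numulDr : right_distributive sa_numul +%R.
Proof. by move=> x y z; apply: val_inj; rewrite /= numulDr. Qed.

Lemma sa_numulZl (c : Phi) x y : sa_numul (c *: x) y = c *: sa_numul x y.
Proof. by apply: val_inj; rewrite /= numulZl. Qed.

Lemma sa_numulZr (c : Phi) x y : sa_numul x (c *: y) = c *: sa_numul x y.
Proof. by apply: val_inj; rewrite /= numulZr. Qed.

HB.instance Definition _ := Lmodule_isNuAlg.Build Phi sa_type
  sa_numulA sa_numulDl sa_numulDr sa_numulZl sa_numulZr.

End SubalgebraType.

Coercion sa_type : subalgebra >-> Sortclass.

Section SymmetricMartindale.
Variables (Phi : comPzRingType) (A : nuAlgType Phi) (sA : semiprime A).
Local Notation Q := (Qmax sA).
Local Notation "a %:Qm" := (Qmax_in sA a) (at level 1, format "a %:Qm").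

Definition Qs_set : set Q :=
  [set q | exists2 I : set A, essential_ideal I &
     forall x y, I x -> I y -> exists a, x%:Qm ** q + q ** y%:Qm = a%:Qm].

Let inM := Qmax_in_morphism sA.

Lemma Qs_setE (q : Q) : Qs_set q <->
  exists2 I : set A, essential_ideal I &
    forall x, I x -> (exists a, x%:Qm ** q = a%:Qm) /\
                     (exists a, q ** x%:Qm = a%:Qm).
Proof.
split=> -[I eI h]; exists I => //.
  have I0 : I 0 by case: eI => -[[[]]].
  move=> x Ix; split.
    by have [a] := h x 0 Ix I0; rewrite (nualg_morphism0 inM) numulr0 addr0; exists a.
  by have [a] := h 0 x I0 Ix; rewrite (nualg_morphism0 inM) numul0r add0r; exists a.
move=> x y /h[[a ->] _] /h[_ [b ->]].
by exists (a + b); rewrite (nualg_morphismD inM).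
Qed.

Lemma Qmax_in_Qs (a : A) : Qs_set a%:Qm.
Proof.
exists [set: A] => [|x y _ _].
  by split=> // J [iJ [x Jx nx]]; exists x.
by exists (x ** a + a ** y); rewrite (nualg_morphismD inM) !inM.2.
Qed.

Lemma Qs_submodule : submodule_set Qs_set.
Proof.
split; first by rewrite -(nualg_morphism0 inM); apply: Qmax_in_Qs.
move=> c q r /Qs_setE[I eI hq] /Qs_setE[J eJ hr]; apply/Qs_setE.
exists (I `&` J) => [|x [/hq[[a ha] [a' ha']] /hr[[b hb] [b' hb']]]].
  exact: essential_idealI.
split; [exists (c *: a + b) | exists (c *: a' + b')]; rewrite inM.1.
  by rewrite numulDr numulZr ha hb.
by rewrite numulDl numulZl ha' hb'.
Qed.

Lemma Qs_mul (q r : Q) : Qs_set q -> Qs_set r -> Qs_set (q ** r).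
Proof.
move=> /Qs_setE[I eI hq] /Qs_setE[J eJ hr]; apply/Qs_setE.
have [iI iJ] := (eI.1, eJ.1).
have [[[I0 ID] Il] Ir] := iI; have [[[J0 JD] Jl] Jr] := iJ.
pose P x := exists2 b, J b & x%:Qm ** q = b%:Qm.
pose P' x := exists2 b, I b & r ** x%:Qm = b%:Qm.
have P0 : P 0 by exists 0; rewrite // (nualg_morphism0 inM) numul0r.
have P'0 : P' 0 by exists 0; rewrite // (nualg_morphism0 inM) numulr0.
have PD c x y : P x -> P y -> P (c *: x + y).
  move=> [u Ju hu] [v Jv hv]; exists (c *: u + v); first exact: JD.
  by rewrite !inM.1 numulDl numulZl hu hv.
have P'D c x y : P' x -> P' y -> P' (c *: x + y).
  move=> [u Iu hu] [v Iv hv]; exists (c *: u + v); first exact: ID.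
  by rewrite !inM.1 numulDr numulZr hu hv.
have Pl b x : P x -> P (b ** x).
  move=> [u Ju hu]; exists (b ** u); first exact: Jl.
  by rewrite inM.2 -numulA hu inM.2.
have P'r b x : P' x -> P' (x ** b).
  move=> [u Iu hu]; exists (u ** b); first exact: Ir.
  by rewrite inM.2 numulA hu inM.2.
pose K := [set x | [/\ P x, P' x & forall a, P (x ** a) /\ P' (a ** x)]].
have iK : ideal K.
  split; first split; first split.
  - by split=> // a; rewrite numul0r numulr0.
  - move=> c x y [Px P'x hx] [Py P'y hy]; split; [exact: PD | exact: P'D |].
    move=> a; rewrite numulDl numulDr numulZl numulZr.
    by split; [apply: PD | apply: P'D]; case: (hx a); case: (hy a).
  - move=> b x [Px P'x hx]; split; [exact: Pl | by case: (hx b) |].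
    move=> a; split; last by rewrite numulA; case: (hx (a ** b)).
    by rewrite -numulA; apply: Pl; case: (hx a).
  move=> b x [Px P'x hx]; split; [by case: (hx b) | exact: P'r |].
  move=> a; split; first by rewrite -numulA; case: (hx (b ** a)).
  by rewrite numulA; apply: P'r; case: (hx a).
have JIP m n : J m -> I n -> P (m ** n).
  move=> Jm /hq[[b hb] _]; exists (m ** b); first exact: Jr.
  by rewrite inM.2 -numulA hb inM.2.
have JIP' m n : J m -> I n -> P' (m ** n).
  move=> /hr[_ [b hb]] In; exists (b ** n); first exact: Il.
  by rewrite inM.2 numulA hb inM.2.
have KP m n : J m -> I n -> K (m ** n).
  move=> Jm In; split; [exact: JIP | exact: JIP' |] => a; split.
    by rewrite -numulA; apply: JIP => //; apply: Ir.
  by rewrite numulA; apply: JIP' => //; apply: Jl.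
exists (I `&` J `&` K).
  split; first by do 2?apply: idealI.
  move=> L nL.
  have [x [IJx Lx] nx] := (essential_idealI eI eJ).2 L nL.
  have nM : nonzero_ideal (I `&` J `&` L).
    by split; [do 2?apply: idealI => //; case: nL | exists x].
  have [m [n [[[Im Jm] Lm] [[In Jn] Ln] nmn]]] := sA nM.
  exists (m ** n) => //; split; last by case: nL => -[_ Lr] _; apply: Lr.
  by split; [split; [apply: Ir | apply: Jr] | apply: KP].
move=> x [[Ix Jx] [[b Jb hb] [b' Ib' hb'] _]]; split.
  by rewrite numulA hb; case: (hr b Jb).
by rewrite -numulA hb'; case: (hq b' Ib').
Qed.

Definition Qs_subalgebra : subalgebra Q := Subalgebra Qs_submodule Qs_mul.

Definition Qs := sa_type Qs_subalgebra.
HB.instance Definition _ := NuAlg.on Qs.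

Definition Qs_in (a : A) : Qs := @sa_elt _ _ Qs_subalgebra _ (Qmax_in_Qs a).

End SymmetricMartindale.

Section Corner.
Variables (Phi : comPzRingType) (B : nuAlgType Phi).

Definition corner_set (e : B) (S : set B) : set B := [set e ** x ** e | x in S].

Lemma corner_submodule e S : submodule_set S -> submodule_set (corner_set e S).
Proof.
move=> [S0 SD]; split; first by exists 0; rewrite // numulr0 numul0r.
move=> c _ _ [x Sx <-] [y Sy <-]; exists (c *: x + y); first exact: SD.
by rewrite numulDr numulDl numulZr numulZl.
Qed.

Lemma full_corner_mul e (x y : B) : corner_set e setT x ->
  corner_set e setT y -> corner_set e setT (x ** y).
Proof.
move=> [x' _ <-] [y' _ <-]; exists (x' ** e ** e ** y') => //.
by rewrite !numulA.
Qed.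

Definition full_corner (e : B) : subalgebra B :=
  Subalgebra (corner_submodule e (S := setT) (conj I (fun _ _ _ _ _ => I)))
    (@full_corner_mul e).

End Corner.

(* e A e, for e in Q_s(A) with eA + Ae contained in A, realized inside
   Q_s(A) through the embedding Qs_in of A. *)
Section CornerOfA.
Variables (Phi : comPzRingType) (A : nuAlgType Phi) (sA : semiprime A).
Variable e : Qs sA.
Local Notation "a %:Qs" := (Qs_in sA a) (at level 1, format "a %:Qs").

Definition idealizes : Prop :=
  forall a b : A, exists c : A, e ** a%:Qs + b%:Qs ** e = c%:Qs.

Lemma Qs_in_morphism : nualg_morphism (Qs_in sA).
Proof.
by split=> [c a b|a b]; apply: val_inj => /=;
  rewrite ((Qmax_in_morphism sA).1, (Qmax_in_morphism sA).2).
Qed.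

Lemma Qs_in_inj : injective (Qs_in sA).
Proof. by move=> a b /(congr1 val)/Qmax_in_inj. Qed.

Lemma range_Qs_submodule : submodule_set (range (Qs_in sA)).
Proof.
split; first by exists 0; rewrite // (nualg_morphism0 Qs_in_morphism).
move=> c _ _ [x _ <-] [y _ <-]; exists (c *: x + y) => //.
by rewrite Qs_in_morphism.1.
Qed.

Hypotheses (he : e ** e = e) (heA : idealizes).

Lemma idealizesl a : exists b, e ** a%:Qs = b%:Qs.
Proof.
have [b] := heA a 0; rewrite (nualg_morphism0 Qs_in_morphism) numul0r addr0.
by exists b.
Qed.

Lemma idealizesr a : exists b, a%:Qs ** e = b%:Qs.
Proof.
have [b] := heA 0 a; rewrite (nualg_morphism0 Qs_in_morphism) numulr0 add0r.
by exists b.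
Qed.

Lemma corner_mul x y : corner_set e (range (Qs_in sA)) x ->
  corner_set e (range (Qs_in sA)) y -> corner_set e (range (Qs_in sA)) (x ** y).
Proof.
move=> [_ [a _ <-] <-] [_ [b _ <-] <-].
have [c hc] := idealizesr a; have [d hd] := idealizesl b.
exists (c ** d)%:Qs; first by exists (c ** d).
by rewrite Qs_in_morphism.2 -hc -hd !numulA.
Qed.

Definition corner : subalgebra (Qs sA) :=
  Subalgebra (corner_submodule e range_Qs_submodule) corner_mul.

Lemma corner_semiprime : semiprime (sa_type corner).
Proof.
move=> I [iI [x Ix nx]]; apply: contrapT => h.
have I2 y z : I y -> I z -> y ** z = 0.
  by move=> Iy Iz; apply: contrapT => /eqP ?; apply: h; exists y, z.
move/eqP: nx; apply; apply: val_inj => /=.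
have [_ [a _ <-] xE] := sa_typeP x.
have [b hb] := idealizesl a; have [c hc] := idealizesr b.
have xc : val x = c%:Qs by rewrite -xE hb hc.
rewrite xc -(nualg_morphism0 Qs_in_morphism); congr (_%:Qs).
apply: (semiprime_elt sA) => y; apply: Qs_in_inj.
have eye : corner_set e (range (Qs_in sA)) (e ** y%:Qs ** e).
  by exists y%:Qs => //; exists y.
pose z := @sa_elt _ _ corner _ eye.
have hx : val x ** (e ** y%:Qs ** e ** val x) = 0.
  exact: (congr1 val (I2 x (z ** x) Ix (iI.1.2 z x Ix))).
have ex : e ** val x = val x by rewrite -xE !numulA he.
have xe : val x ** e = val x by rewrite -xE -!numulA he.
rewrite (nualg_morphism0 Qs_in_morphism) !Qs_in_morphism.2 -!xc -[RHS]hx.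
by rewrite -(numulA _ e (val x)) ex !numulA xe.
Qed.

End CornerOfA.

Arguments corner_semiprime {Phi A sA e} he heA.

(* Main.v *)
Require Import Defs.
From mathcomp Require Import all_boot all_algebra.
From mathcomp Require Import boolp classical_sets.

Set Implicit Arguments.
Unset Strict Implicit.
Unset Printing Implicit Defensive.

Import GRing.Theory.
Local Open Scope quotient_scope.
Local Open Scope classical_set_scope.
Local Open Scope ring_scope.

(** Write C = eAe, which lies in A because eA + Ae does, and Q = Qs(A).

    The corner eQe is a left quotient algebra of C: a nonzero p in eQe is moved
    by some element of C to a nonzero element of C
    ([full_corner_nonzero]), and every p in eQe is multiplied into C, on both
    sides, by the ideal I inter C of C, where I is an essential ideal of A
    with Ip + pI in A; that ideal is essential in C
    ([corner_restrict_essential]).  By maximality eQe embeds in Qmax(C) over C,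
    and because of the two-sided ideals I inter C the image lies in Qs(C)
    ([full_corner_embedding]).

    The substance is surjectivity.  Given q in Qs(C) and an essential ideal J
    of C with Jq + qJ in C, one wants p in Q with cp = cq for c in J; then
    epe is a preimage of q.  Such a p is glued from right multiplication
    x |-> xp and left multiplication y |-> py on an essential ideal of A
    ([Qs_of_pair]).  Instead of defining these maps on the ideal AJA plus its
    annihilator by formulas, with well-definedness to check on sums, they are
    given by their graphs: z is the value xp when z = ze and
    (e y x e) q = e y z e for all y in A, an equation between elements of
    Qs(C).  Elements of A with z = ze are determined by their corners e y z e
    ([corner_separates]), so the value is unique, and the same principle shows
    the two maps to be compatible, (xp)y = x(py) ([values_compatible]).  The
    elements on which both maps are defined, together with their multiples,
    form an ideal of A.  It contains J, and it contains the square of every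
    ideal M of A that does not meet C, since e M^2 e = 0 for such M; as A is
    semiprime, the ideal is essential ([lift_domain_essential]). *)

(** * Isomorphisms *)

Section Isomorphic.
Variable Phi : comPzRingType.

Lemma nualg_isomorphic_sym (A B : nuAlgType Phi) :
  nualg_isomorphic A B -> nualg_isomorphic B A.
Proof.
move=> [f [fl fM] [g gf fg]]; exists g; last by exists f.
split=> [c x y|x y]; apply: (can_inj gf).
  by rewrite fl !fg.
by rewrite fM !fg.
Qed.

Lemma inj_surj_bijective (T U : Type) (f : T -> U) :
  injective f -> (forall y, exists x, f x = y) -> bijective f.
Proof.
move=> fI fS; have [g gE] := choice fS.
by exists g => // x; apply: fI; rewrite gE.
Qed.

End Isomorphic.

(** * Essential ideals and the symmetric quotient algebra *)

Section EssentialIdeals.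
Variables (Phi : comPzRingType) (A : nuAlgType Phi) (sA : semiprime A).
Implicit Types (I : set A) (x y : A).

(** The right annihilator of I is an ideal, and its intersection with I squares
    to zero. *)
Lemma essential_faithful I x :
  essential_ideal I -> (forall i, I i -> i ** x = 0) -> x = 0.
Proof.
move=> [[[[I0 ID] Il] Ir] eI] Ix0.
pose N := [set y : A | forall i, I i -> i ** y = 0].
have iN : ideal N.
  split; first split; first split.
  - by move=> i _; rewrite numulr0.
  - move=> c y z hy hz i Ii.
    by rewrite numulDr numulZr hy // hz // scaler0 addr0.
  - by move=> a y hy i Ii; rewrite numulA hy //; apply: Ir.
  by move=> a y hy i Ii; rewrite numulA hy // numul0r.
have iI : ideal I by [].
have NI0 : forall y, (N `&` I) y -> y = 0.
  apply: (semiprime_sqr0 sA); first exact: idealI.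
  by move=> y z [_ Iy] [Nz _]; apply: Nz.
apply: contrapT => /eqP nx.
have [|y [Iy Ny] /eqP[]] := eI N; first by split=> //; exists x.
exact: NI0.
Qed.

Lemma essential_dense I : essential_ideal I -> dense_left_ideal I.
Proof.
move=> eI; split; first by case: eI => -[].
move=> p q /eqP np; apply: contrapT => h; apply: np.
apply: (essential_faithful eI) => i Ii; apply: contrapT => /eqP nip.
by apply: h; exists i; split=> //; apply: eI.1.2.
Qed.

(** For i in I and a in A, the hypothesis at a ** i gives
    (i x) a (i x) = 0, so semiprimeness kills i x. *)
Lemma essential_semiprime_elt I x :
  essential_ideal I -> (forall i, I i -> x ** i ** x = 0) -> x = 0.
Proof.
move=> eI h; apply: (essential_faithful eI) => i Ii.
apply: (semiprime_elt sA) => a.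
have Iai : I (a ** i) by apply: eI.1.1.2.
by have := h _ Iai; rewrite -!numulA => ->; rewrite numulr0.
Qed.

Lemma Qmax_faithful I (q : Qmax sA) :
  dense_left_ideal I -> (forall i, I i -> Qmax_in sA i ** q = 0) -> q = 0.
Proof.
move=> [_ Id] Iq; apply: contrapT => /eqP nq.
have [inM inI /(_ q q nq)[a [naq [b ab]]]] := Qmax_left_quotient sA.
have nb : b != 0.
  by apply: contra_neq naq => b0; rewrite ab b0 (nualg_morphism0 inM).
have [c [ncb Ica]] := Id b a nb; move/eqP: ncb; apply.
by apply: inI; rewrite (nualg_morphism0 inM) inM.2 -ab numulA -inM.2 Iq.
Qed.

Lemma Qs_faithful I (q : Qs sA) :
  essential_ideal I -> (forall i, I i -> Qs_in sA i ** q = 0) -> q = 0.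
Proof.
move=> eI Iq; apply: val_inj; apply: (Qmax_faithful (essential_dense eI)).
by move=> i Ii; apply: (congr1 val (Iq i Ii)).
Qed.

Lemma Qs_essential (q : Qs sA) :
  exists2 I : set A, essential_ideal I &
    forall x, I x -> (exists a, Qs_in sA x ** q = Qs_in sA a) /\
                     (exists a, q ** Qs_in sA x = Qs_in sA a).
Proof.
have /Qs_setE[I eI hI] := sa_typeP q; exists I => // x /hI[[a ha] [b hb]].
by split; [exists a | exists b]; apply: val_inj.
Qed.

(** Elements of Qs(A) are glued from a left-linear map F and a map G, standing
    for x |-> xq and y |-> qy, defined on an essential ideal and linked by
    F(x) y = x G(y).  The class of F is an element q of Qmax(A), and the link
    says x (q y) = x G(y), whence q y = G(y) by faithfulness.  The maps are
    given as graphs, so that a caller can specify them by equations; F has one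
    value at most because it is linear and single-valued at 0. *)
Lemma Qs_of_pair (E : set A) (F G : A -> A -> Prop) :
  essential_ideal E ->
  (forall c x y z w, F x z -> F y w -> F (c *: x + y) (c *: z + w)) ->
  (forall a x z, F x z -> F (a ** x) (a ** z)) ->
  (forall z, F 0 z -> z = 0) ->
  (forall x, E x -> exists z, F x z) ->
  (forall y, E y -> exists w, G y w) ->
  (forall x z y w, F x z -> G y w -> z ** y = x ** w) ->
  exists q : Qs sA, forall x z, E x -> F x z -> Qs_in sA x ** q = Qs_in sA z.
Proof.
move=> eE FD FM F0 exF exG FG.
have Funiq x z w : F x z -> F x w -> z = w.
  move=> Fz Fw; apply/esym/eqP; rewrite -subr_eq0; apply/eqP/F0.
  by have := FD (-1) _ _ _ _ Fz Fw; rewrite !scaleN1r addNr addrC.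
have /choice[f fE] : forall x, exists z, E x -> F x z.
  move=> x; case: (pselect (E x)) => [/exF[z ?]|nE]; first by exists z.
  by exists 0 => /nE.
have [[[_ ED] El] Er] := eE.1.
have fD c x y : E x -> E y -> f (c *: x + y) = c *: f x + f y.
  move=> Ex Ey; apply: (@Funiq (c *: x + y)); first exact/fE/ED.
  by apply: FD; apply: fE.
have fM a x : E x -> f (a ** x) = a ** f x.
  move=> Ex; apply: (@Funiq (a ** x)); first exact/fE/El.
  exact/FM/fE.
pose g := PHom (essential_dense eE) fD fM.
pose q : Qmax sA := \pi_(Qmax sA) g.
have qE x z : E x -> F x z -> Qmax_in sA x ** q = Qmax_in sA z.
  move=> Ex Fxz; rewrite (@Qmax_in_mul _ _ sA g x Ex) /=.
  by rewrite (Funiq _ _ _ (fE x Ex) Fxz).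
have inM := Qmax_in_morphism sA.
have Sq : Qs_set q.
  apply/Qs_setE; exists E => // y Ey; split.
    by have [z Fz] := exF y Ey; exists z; apply: qE.
  have [w Gw] := exG y Ey; exists w; apply/eqP; rewrite -subr_eq0; apply/eqP.
  apply: (Qmax_faithful (essential_dense eE)) => x Ex.
  have [z Fz] := exF x Ex.
  by rewrite numulBr numulA (qE x z) // -!inM.2 (FG x z y w) // subrr.
exists (@sa_elt _ _ (Qs_subalgebra sA) _ Sq) => x z Ex Fz.
by apply: val_inj; apply: qE.
Qed.

End EssentialIdeals.

(** * Elements of the corner eAe *)

Section Corner.
Variables (Phi : comPzRingType) (A : nuAlgType Phi) (sA : semiprime A).
Variables (e : Qs sA) (he : e ** e = e) (heA : idealizes e).
Local Notation C := (corner heA).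
Local Notation sC := (corner_semiprime he heA).
Local Notation j := (Qs_in sA).
Let jM := Qs_in_morphism sA.
Let jI := @Qs_in_inj _ _ sA.

Lemma to_cornerP (a : A) : sa_set C (e ** j a ** e).
Proof. by exists (j a) => //; exists a. Qed.

Definition to_corner (a : A) : C := sa_elt (to_cornerP a).
Local Notation k := to_corner.

Lemma corner_in_base (c : C) : exists a, val c = j a.
Proof.
have [_ [a _ <-] <-] := sa_typeP c.
by have [b ->] := idealizesl heA a; apply: idealizesr.
Qed.

Lemma corner_idl (c : C) : e ** val c = val c.
Proof. by have [_ [a _ <-] <-] := sa_typeP c; rewrite !numulA he. Qed.

Lemma corner_idr (c : C) : val c ** e = val c.
Proof. by have [_ [a _ <-] <-] := sa_typeP c; rewrite -!numulA he. Qed.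

Lemma to_cornerK (c : C) x : j x = val c -> k x = c.
Proof. by move=> xc; apply: val_inj; rewrite /= xc corner_idl corner_idr. Qed.

Lemma to_corner_linear (c : Phi) x y : k (c *: x + y) = c *: k x + k y.
Proof.
by apply: val_inj; rewrite /= jM.1 numulDr numulDl numulZr numulZl.
Qed.

Lemma to_corner0 : k 0 = 0.
Proof.
by apply: val_inj; rewrite /= (nualg_morphism0 jM) numulr0 numul0r.
Qed.

Lemma to_cornerB x y : k (x - y) = k x - k y.
Proof. by rewrite -(scaleN1r y) addrC to_corner_linear scaleN1r addrC. Qed.

Lemma to_cornerMl x y : j x ** e = j x -> k (x ** y) = k x ** k y.
Proof.
move=> xe; apply: val_inj; rewrite /= jM.2.
by rewrite -{1}xe -(numulA e (j x) e) xe !numulA -(numulA e (j x) e) xe.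
Qed.

Lemma to_cornerMr x y : e ** j y = j y -> k (x ** y) = k x ** k y.
Proof.
move=> ey; apply: val_inj; rewrite /= jM.2 ey.
rewrite !numulA.
by rewrite -(numulA (e ** j x) e (j y)) ey.
Qed.

(** If z = ze then z y z = z (e y z e), so that z vanishes by semiprimeness as
    soon as all the corners e y z e do. *)
Lemma corner_separates z :
  j z ** e = j z -> (forall y, k (y ** z) = 0) -> z = 0.
Proof.
move=> ze h; apply: (semiprime_elt sA) => y; apply: jI.
have := congr1 val (h y); rewrite /= jM.2 => h0.
rewrite (nualg_morphism0 jM) !jM.2 -{1}ze.
rewrite -[RHS](numulr0 (j z)) -[in RHS]h0.
by rewrite !numulA -(numulA _ (j z) e) ze.
Qed.

(** For each y in A, e y (d v e) e = e (y d v) e = 0, so d v e = 0; here x names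
    the element v e of A. *)
Lemma corner_killed d v x :
  (forall u w, k (u ** d ** w) = 0) -> j x = j v ** e -> d ** x = 0.
Proof.
move=> h xv; apply: corner_separates => [|y].
  by rewrite jM.2 xv -!numulA he.
have : k (y ** (d ** x)) = k (y ** d ** v).
  by apply: val_inj; rewrite /= !jM.2 xv -!numulA he.
by rewrite h.
Qed.

(** * Restriction of ideals of A to the corner *)

Definition corner_restrict (I : set A) : set C :=
  [set c | exists2 a, I a & val c = j a].


Lemma corner_restrict_ideal I : ideal I -> ideal (corner_restrict I).
Proof.
move=> [[[I0 ID] Il] Ir]; split; first split; first split.
- by exists 0 => //=; rewrite (nualg_morphism0 jM).
- move=> t x y [a Ia ha] [b Ib hb]; exists (t *: a + b); first exact: ID.
  by rewrite jM.1 -ha -hb.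
- move=> c x [a Ia ha]; have [b hb] := corner_in_base c.
  by exists (b ** a); [apply: Il | rewrite jM.2 -ha -hb].
move=> c x [a Ia ha]; have [b hb] := corner_in_base c.
by exists (a ** b); [apply: Ir | rewrite jM.2 -ha -hb].
Qed.

(** A nonzero element x of an ideal of C satisfies x i x != 0 for some i in I.
    As x = exe, this product is x (e i e) x, in the given ideal of C, and it
    also lies in I. *)
Lemma corner_restrict_essential I :
  essential_ideal I -> essential_ideal (corner_restrict I).
Proof.
move=> eI; split; first by apply: corner_restrict_ideal; case: eI.
move=> J [iJ [x Jx nx]]; have [a xa] := corner_in_base x.
have [i Ii naia] : exists2 i, I i & a ** i ** a != 0.
  apply: contrapT => h; move/eqP: nx; apply; apply: val_inj => /=.
  rewrite xa -(nualg_morphism0 jM); congr (j _).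
  apply: (essential_semiprime_elt sA eI) => i Ii.
  by apply: contrapT => /eqP ?; apply: h; exists i.
have xix : val (x ** k i ** x) = j (a ** i ** a).
  by rewrite /= !jM.2 -xa !numulA corner_idr -!numulA corner_idl.
exists (x ** k i ** x); last first.
  apply: contra_neq naia => x0; apply: jI.
  by rewrite -xix x0 (nualg_morphism0 jM).
split; last by apply: iJ.1.2.
exists (a ** i ** a) => //.
by apply: eI.1.2; apply: eI.1.1.2.
Qed.

(** * The corner of Qs(A) as a left quotient algebra of eAe *)

Lemma corner_in_full (c : C) : sa_set (full_corner e) (val c).
Proof. by exists (val c) => //; rewrite corner_idl corner_idr. Qed.

Definition full_of_corner (c : C) : full_corner e := sa_elt (corner_in_full c).
Local Notation i := full_of_corner.

Lemma full_idl (p : full_corner e) : e ** val p = val p.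
Proof. by have [a _ <-] := sa_typeP p; rewrite !numulA he. Qed.

Lemma full_idr (p : full_corner e) : val p ** e = val p.
Proof. by have [a _ <-] := sa_typeP p; rewrite -!numulA he. Qed.

Lemma full_of_corner_morphism : nualg_morphism i.
Proof. by split=> *; apply: val_inj. Qed.

Lemma full_of_corner_inj : injective i.
Proof. by move=> x y /(congr1 val) xy; apply: val_inj. Qed.

(** Compressing by e handles both sides at once for any p of Qs(A); for p in the
    corner of e the outer factors e are absorbed. *)
Lemma Qs_corner_multiplier (p : Qs sA) : exists2 J : set C, essential_ideal J &
  forall c, J c -> (exists d : C, e ** (val c ** p) ** e = val d) /\
                   (exists d : C, e ** (p ** val c) ** e = val d).
Proof.
have [I eI hI] := Qs_essential p.
exists (corner_restrict I) => [|c [a /hI[[x hx] [y hy]] ->]].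
  exact: corner_restrict_essential.
by rewrite hx hy; split; [exists (k x) | exists (k y)].
Qed.

Lemma full_corner_multiplier (p : full_corner e) :
  exists2 J : set C, essential_ideal J &
  forall c, J c -> (exists d, i c ** p = i d) /\ (exists d, p ** i c = i d).
Proof.
have [J eJ hJ] := Qs_corner_multiplier (val p).
exists J => // c /hJ[[d hd] [d' hd']]; split.
  exists d; apply: val_inj; rewrite /= -hd.
  by rewrite numulA corner_idl -numulA full_idr.
exists d'; apply: val_inj; rewrite /= -hd'.
by rewrite numulA full_idl -numulA corner_idr.
Qed.

(** Take a in A with b = ap in A and b != 0.  Since b = be, some corner
    e y b e is nonzero, and e y b e = (e y a e) p because p = ep. *)
Lemma full_corner_nonzero (p : full_corner e) : p != 0 ->
  exists c d, i c ** p = i d /\ d != 0.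
Proof.
move=> np.
have nvp : val (val p) != 0.
  by apply: contra_neq np => p0; apply: val_inj; apply: val_inj.
have [_ _ /(_ _ (val (val p)) nvp)[a [nap [b ab]]]] := Qmax_left_quotient sA.
have {nap} nb : b != 0.
  apply: contra_neq nap => b0.
  by rewrite ab b0 (nualg_morphism0 (Qmax_in_morphism sA)).
have {}ab : j a ** val p = j b by apply: val_inj.
have be : j b ** e = j b by rewrite -ab -numulA full_idr.
have [y ny] : exists y, k (y ** b) != 0.
  apply: contrapT => h; move/eqP: nb; apply; apply: corner_separates => // y.
  by apply: contrapT => /eqP ?; apply: h; exists y.
exists (k (y ** a)), (k (y ** b)); split=> //; apply: val_inj => /=.
by rewrite !jM.2 -ab -!numulA !full_idl full_idr.
Qed.

(** A first multiplier c in C sends p to some d != 0 in C.  The ideal that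
    multiplies q into C is dense, so a further multiplier x brings c into it
    while keeping x d nonzero. *)
Lemma full_corner_left_quotient : left_quotient_algebra i.
Proof.
split; [exact: full_of_corner_morphism | exact: full_of_corner_inj |].
move=> p q np; have [c [d [cp nd]]] := full_corner_nonzero np.
have [J eJ hJ] := full_corner_multiplier q.
have [x [nxd Jxc]] := (essential_dense sC eJ).2 d c nd.
exists (x ** c); split; last by case: (hJ _ Jxc).
rewrite full_of_corner_morphism.2 -numulA cp -full_of_corner_morphism.2.
apply: contra_neq nxd => xd0; apply: full_of_corner_inj.
by rewrite xd0 (nualg_morphism0 full_of_corner_morphism).
Qed.

Lemma full_corner_embedding : exists h : full_corner e -> Qs sC,
  [/\ nualg_morphism h, injective h & forall c, h (i c) = Qs_in sC c].
Proof.
have [h [hM hI hE]] := Qmax_maximal sC full_corner_left_quotient.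
have Sh p : Qs_set (h p).
  have [J eJ hJ] := full_corner_multiplier p.
  apply/Qs_setE; exists J => // c /hJ[[d hd] [d' hd']].
  by split; [exists d | exists d']; rewrite -!hE -hM.2 (hd, hd').
exists (fun p => @sa_elt _ _ (Qs_subalgebra sC) _ (Sh p)); split.
- by split=> *; apply: val_inj; rewrite /= (hM.1, hM.2).
- by move=> p p' /(congr1 val)/hI.
by move=> c; apply: val_inj; apply: hE.
Qed.

(** * Lifting elements of Qs(eAe) to Qs(A) *)

Section Lift.
Variable q : Qs sC.

(** z is the product x p, where p = epe is the element of Qs(A) to be built from
    q.  Multiplying x p by e y on the left gives (e y x e) q, and this is the
    only information about it that q provides; z = ze makes it
    sufficient. *)
Definition right_value (x z : A) : Prop :=
  j z ** e = j z /\
  forall y, Qs_in sC (k (y ** x)) ** q = Qs_in sC (k (y ** z)).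

(** Likewise w is the product p x. *)
Definition left_value (x w : A) : Prop :=
  e ** j w = j w /\
  forall y, q ** Qs_in sC (k (x ** y)) = Qs_in sC (k (w ** y)).

Let inM := Qs_in_morphism sC.
Let inI := @Qs_in_inj _ _ sC.

Lemma right_value_linear c x y z w : right_value x z -> right_value y w ->
  right_value (c *: x + y) (c *: z + w).
Proof.
move=> [ze hz] [we hw]; split=> [|a].
  by rewrite jM.1 numulDl numulZl ze we.
rewrite !numulDr !numulZr !to_corner_linear !inM.1 numulDl numulZl.
by rewrite hz hw.
Qed.

Lemma left_value_linear c x y z w : left_value x z -> left_value y w ->
  left_value (c *: x + y) (c *: z + w).
Proof.
move=> [ze hz] [we hw]; split=> [|a].
  by rewrite jM.1 numulDr numulZr ze we.
rewrite !numulDl !numulZl !to_corner_linear !inM.1 numulDr numulZr.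
by rewrite hz hw.
Qed.

Lemma right_value_mul a x z : right_value x z -> right_value (a ** x) (a ** z).
Proof.
move=> [ze hz]; split=> [|y]; first by rewrite jM.2 -numulA ze.
by rewrite !numulA.
Qed.

Lemma left_value_mul a x z : left_value x z -> left_value (x ** a) (z ** a).
Proof.
move=> [ze hz]; split=> [|y]; first by rewrite jM.2 numulA ze.
by rewrite -!numulA.
Qed.

Lemma right_value0 z : right_value 0 z -> z = 0.
Proof.
move=> [ze hz]; apply: corner_separates => // y; apply: inI.
by rewrite -hz numulr0 to_corner0 (nualg_morphism0 inM) numul0r.
Qed.

(** Let d = zy - xw, to be read as (xp)y - x(py).  Each corner of u d v is zero:
    both terms give (e u x e) q (e y v e).  Hence d t = 0 whenever t = te in A.
    Since z = ze and w = ew, both terms of d u d = (d u z) y - (d u x e) w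
    vanish, and d = 0 by semiprimeness. *)
Lemma values_compatible x z y w :
  right_value x z -> left_value y w -> z ** y = x ** w.
Proof.
move=> [ze hz] [ew hw]; apply/eqP; rewrite -subr_eq0; apply/eqP.
set d := z ** y - x ** w.
have kd u v : k (u ** d ** v) = 0.
  rewrite numulBr numulBl to_cornerB; apply/eqP; rewrite subr_eq0; apply/eqP.
  apply: inI.
  have uze : j (u ** z) ** e = j (u ** z) by rewrite jM.2 -numulA ze.
  have ewv : e ** j (w ** v) = j (w ** v) by rewrite jM.2 numulA ew.
  rewrite numulA -(numulA (u ** z)) (to_cornerMl _ uze).
  rewrite numulA -(numulA (u ** x)) (to_cornerMr _ ewv).
  by rewrite !inM.2 -hz -hw numulA.
apply: (semiprime_elt sA) => u; rewrite {2}/d numulBr !numulA.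
have [t ht] := idealizesr heA x.
rewrite -(numulA d u z).
have -> : d ** (u ** z) = 0.
  by apply: (corner_killed (v := u ** z)) => //; rewrite jM.2 -numulA ze.
have xw : x ** w = t ** w by apply: jI; rewrite !jM.2 -ht -numulA ew.
rewrite numul0r -(numulA (d ** u)) xw numulA -(numulA d).
have -> : d ** (u ** t) = 0.
  by apply: (corner_killed (v := u ** x)) => //; rewrite !jM.2 -ht numulA.
by rewrite numul0r subr0.
Qed.

(** For x = ex the corner e y x e is (e y e) (e x e), so the value
    (e x e) q in C works for every y. *)
Lemma right_value_exists (J : set C) x :
  (forall c, J c -> exists d, Qs_in sC c ** q = Qs_in sC d) ->
  e ** j x = j x -> J (k x) -> exists z, right_value x z.
Proof.
move=> hJ ex /hJ[d hd]; have [z dz] := corner_in_base d.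
have ez : e ** j z = j z by rewrite -dz corner_idl.
exists z; split=> [|y]; first by rewrite -dz corner_idr.
by rewrite !to_cornerMr // (to_cornerK (esym dz)) !inM.2 -numulA hd.
Qed.

Lemma left_value_exists (J : set C) x :
  (forall c, J c -> exists d, q ** Qs_in sC c = Qs_in sC d) ->
  j x ** e = j x -> J (k x) -> exists w, left_value x w.
Proof.
move=> hJ xe /hJ[d hd]; have [z dz] := corner_in_base d.
have ze : j z ** e = j z by rewrite -dz corner_idr.
exists z; split=> [|y]; first by rewrite -dz corner_idl.
by rewrite !to_cornerMl // (to_cornerK (esym dz)) !inM.2 numulA hd.
Qed.

(** The values [right_value] are inherited by left multiples of x but not by
    right ones, and symmetrically for [left_value]; asking for the missing
    values makes the domain a two-sided ideal. *)
Definition lift_domain : set A :=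
  [set x | [/\ exists z, right_value x z, exists w, left_value x w,
               forall b, exists z, right_value (x ** b) z &
               forall a, exists w, left_value (a ** x) w]].

Lemma lift_domain_ideal : ideal lift_domain.
Proof.
have F0 : right_value 0 0.
  split=> [|y]; first by rewrite (nualg_morphism0 jM) numul0r.
  by rewrite numulr0 to_corner0 (nualg_morphism0 inM) numul0r.
have G0 : left_value 0 0.
  split=> [|y]; first by rewrite (nualg_morphism0 jM) numulr0.
  by rewrite numul0r to_corner0 (nualg_morphism0 inM) numulr0.
split; first split; first split.
- by split; [exists 0 | exists 0 | move=> b; rewrite numul0r; exists 0
            | move=> b; rewrite numulr0; exists 0].
- move=> c x y [[z hz] [w hw] hr hl] [[z' hz'] [w' hw'] hr' hl']; split.
  + by eexists; apply: right_value_linear; eassumption.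
  + by eexists; apply: left_value_linear; eassumption.
  + move=> b; have [u hu] := hr b; have [u' hu'] := hr' b.
    rewrite numulDl numulZl.
    by eexists; apply: right_value_linear; eassumption.
  move=> b; have [u hu] := hl b; have [u' hu'] := hl' b.
  rewrite numulDr numulZr.
  by eexists; apply: left_value_linear; eassumption.
- move=> a x [[z hz] [w hw] hr hl]; split.
  + by exists (a ** z); apply: right_value_mul.
  + exact: hl.
  + move=> b; have [u hu] := hr b; exists (a ** u).
    by rewrite -numulA; apply: right_value_mul.
  by move=> b; rewrite numulA; apply: hl.
move=> a x [[z hz] [w hw] hr hl]; split.
- exact: hr.
- by exists (w ** a); apply: left_value_mul.
- by move=> b; rewrite -numulA; apply: hr.
move=> b; have [u hu] := hl b; exists (u ** a).
by rewrite numulA; apply: left_value_mul.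
Qed.

Lemma lift_domain_corner (J : set C) c x : ideal J ->
  (forall c, J c -> (exists d, Qs_in sC c ** q = Qs_in sC d) /\
                    (exists d, q ** Qs_in sC c = Qs_in sC d)) ->
  J c -> val c = j x -> lift_domain x.
Proof.
move=> [[_ Jl] Jr] hJ Jc cx.
have hl d : J d -> exists d', Qs_in sC d ** q = Qs_in sC d' by case/hJ.
have hr d : J d -> exists d', q ** Qs_in sC d = Qs_in sC d' by case/hJ.
have ex : e ** j x = j x by rewrite -cx corner_idl.
have xe : j x ** e = j x by rewrite -cx corner_idr.
have kx := to_cornerK (esym cx).
split.
- by apply: (right_value_exists hl); rewrite ?kx.
- by apply: (left_value_exists hr); rewrite ?kx.
- move=> b; apply: (right_value_exists hl); first by rewrite jM.2 numulA ex.
  by rewrite to_cornerMl // kx; apply: Jr.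
move=> b; apply: (left_value_exists hr); first by rewrite jM.2 -numulA xe.
by rewrite to_cornerMr // kx; apply: Jl.
Qed.

(** An ideal M that meets C meets J, which lies in the domain.  If M does not
    meet C, all corners e a b e with a, b in M vanish, so 0 is a value, on
    either side, of every product of two elements of M, and some such product is
    nonzero. *)
Lemma lift_domain_essential : essential_ideal lift_domain.
Proof.
split; first exact: lift_domain_ideal.
have [J eJ hJ] := Qs_essential q.
move=> M [iM nM].
case: (pselect (exists2 c, corner_restrict M c & c != 0)) => [[c Mc nc]|M0].
  have iMC := corner_restrict_ideal iM.
  have [c' [Jc' [x Mx c'x]] nc'] := eJ.2 _ (conj iMC (ex_intro2 _ _ c Mc nc)).
  exists x; first by split=> //; apply: (lift_domain_corner eJ.1 hJ Jc').
  apply: contra_neq nc' => x0; apply: val_inj => /=.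
  by rewrite c'x x0 (nualg_morphism0 jM).
have {nM} [m [n [Mm Mn nmn]]] := sA (conj iM nM).
have k0 a b : M a -> M b -> k (a ** b) = 0.
  move=> Ma Mb; apply: contrapT => /eqP nk; apply: M0.
  (* Writing c for e a b e, the product c y c = (e a) b (e y c) lies in M,
     although c itself need not. *)
  have [y ny] : exists y, k (a ** b) ** y ** k (a ** b) != 0.
    apply: contrapT => h; move/eqP: nk; apply; apply: (semiprime_elt sC) => y.
    by apply: contrapT => /eqP ?; apply: h; exists y.
  exists (k (a ** b) ** y ** k (a ** b)) => //.
  have [a' ha] := idealizesl heA a.
  have [t ht] := corner_in_base (y ** k (a ** b)).
  exists (a' ** (b ** t)); first by apply: iM.1.2; apply: iM.2.
  by rewrite !jM.2 -ht -ha /= jM.2 -(corner_idl y) !numulA -(numulA _ e e) he.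
have F0 a b : M a -> M b -> right_value (a ** b) 0.
  move=> Ma Mb; split=> [|y]; first by rewrite (nualg_morphism0 jM) numul0r.
  rewrite numulA k0 ?numulr0 ?to_corner0 ?(nualg_morphism0 inM) ?numul0r //.
  exact: iM.1.2.
have G0 a b : M a -> M b -> left_value (a ** b) 0.
  move=> Ma Mb; split=> [|y]; first by rewrite (nualg_morphism0 jM) numulr0.
  rewrite -numulA k0 ?numul0r ?to_corner0 ?(nualg_morphism0 inM) ?numulr0 //.
  exact: iM.2.
exists (m ** n) => //; split; last exact: iM.2.
split; [by exists 0; apply: F0 | by exists 0; apply: G0 | |] => a; exists 0.
  by rewrite -numulA; apply: F0 => //; apply: iM.2.
by rewrite numulA; apply: G0 => //; apply: iM.1.2.
Qed.

Lemma Qs_corner_lift : exists p : Qs sA, exists2 J : set C, essential_ideal J &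
  forall c, J c -> exists2 d, Qs_in sC c ** q = Qs_in sC d & val c ** p = val d.
Proof.
have [|||||||p pE] := @Qs_of_pair _ _ sA lift_domain right_value left_value.
- exact: lift_domain_essential.
- exact: right_value_linear.
- exact: right_value_mul.
- exact: right_value0.
- by move=> x [].
- by move=> x [].
- exact: values_compatible.
have [J eJ hJ] := Qs_essential q.
exists p, J => // c Jc; have [[d hd] _] := hJ c Jc; exists d => //.
have [x cx] := corner_in_base c; have [z dz] := corner_in_base d.
rewrite cx dz; apply: pE.
  exact: (lift_domain_corner eJ.1 hJ Jc).
have ex : e ** j x = j x by rewrite -cx corner_idl.
have ez : e ** j z = j z by rewrite -dz corner_idl.
split=> [|y]; first by rewrite -dz corner_idr.
rewrite !to_cornerMr // (to_cornerK (esym dz)) (to_cornerK (esym cx)).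
by rewrite !inM.2 -numulA hd.
Qed.

End Lift.

(** With p the lift of q, epe is a preimage of q: for c in J the product c (epe)
    is (cp) e = (cq) e = cq. *)
Lemma full_corner_embedding_surj (h : full_corner e -> Qs sC) :
  nualg_morphism h -> (forall c, h (i c) = Qs_in sC c) ->
  forall q, exists p, h p = q.
Proof.
move=> hM hE q; have [p [J eJ hJ]] := Qs_corner_lift q.
have Sp : sa_set (full_corner e) (e ** p ** e) by exists p.
exists (sa_elt Sp); apply/eqP; rewrite -subr_eq0; apply/eqP.
apply: (Qs_faithful eJ) => c Jc.
have [d qd pd] := hJ c Jc.
rewrite numulBr qd -!hE -hM.2; apply/eqP; rewrite subr_eq0; apply/eqP.
congr (h _); apply: val_inj => /=.
by rewrite !numulA corner_idr pd corner_idr.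
Qed.

End Corner.

(** * The isomorphism *)

Theorem corollary2p6 (Phi : comPzRingType) (A : nuAlgType Phi)
    (sA : semiprime A) (e : Qs sA) (he : e ** e = e)
    (heA : forall a b : A,
       exists c : A, e ** Qs_in sA a + Qs_in sA b ** e = Qs_in sA c) :
  nualg_isomorphic (Qs (corner_semiprime he heA)) (full_corner e).
Proof.
apply: nualg_isomorphic_sym.
have [h [hM hI hE]] := full_corner_embedding he heA.
exists h => //; apply: inj_surj_bijective => //.
exact: full_corner_embedding_surj.
Qed.
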